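(* Let $G$ be a finite alphabet, let $\mathfrak{G}\subseteq G^{\mathbb{Z}}$ be a topological Markov chain using all letters of $G$, let $N\ge 2$, and let $(\mathfrak{G},\Phi)$ be a structurally compatible, right-permutative, $N$-scaling cellular automaton. If its extension $(G^{\mathbb{Z}},\tilde{\Phi})$ to the full shift is also an $N$-scaling cellular automaton, then $(\mathfrak{G},\Phi)$ is topologically conjugate through a $1$-block code to a product $(\mathfrak{K}\times\mathfrak{B},\Phi_{\mathfrak{K}}\times\mathbf{g}_{\mathfrak{B}})$, where $\mathfrak{K}$ and $\mathfrak{B}$ are topological Markov chains, $(\mathfrak{K},\Phi_{\mathfrak{K}})$ is an affine cellular automaton, and $(\mathfrak{B},\mathbf{g}_{\mathfrak{B}})$ is a translation.
   Context: $\sigma$ is the shift map, $(\sigma(\mathbf{g}))_n=g_{n+1}$. A subshift $\mathfrak{G}\subseteq G^{\mathbb{Z}}$ is a topological Markov chain if for every allowed word $(g_1,\dots,g_k)$ the set of letters that may follow it depends only on $g_k$. A $1$-block code is a map $\Theta$ between shift spaces of the form $(\Theta(\mathbf{x}))_j=\theta(x_j)$ for a map $\theta$ of letters. Topologically conjugate through a $1$-block code means that there is a homeomorphism that is a $1$-block code and intertwines the two maps. A cellular automaton $(\mathfrak{G},\Phi)$ with radio $1$ is given by a map $\phi:G\times G\to G$ (the local rule) such that $\Phi(\mathbf{x})=(\phi(x_i,x_{i+1}))_{i\in\mathbb{Z}}$ maps $\mathfrak{G}$ into $\mathfrak{G}$; write $a\bullet b:=\phi(a,b)$. Its extension $\tilde\Phi:G^{\mathbb{Z}}\to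 G^{\mathbb{Z}}$ is the cellular automaton on the full shift with the same local rule $\phi$. It is structurally compatible if it has radio $1$ and $(x_i),(y_i)\in\mathfrak{G}$ implies $(x_i\bullet y_i)_{i\in\mathbb{Z}}\in\mathfrak{G}$. It is right permutative if $g\mapsto w\bullet g$ is a permutation of $G$ for each $w\in G$. It is $N$-scaling ($N\ge2$) if $(\Phi^N(\mathbf{x}))_0=x_0\bullet x_N$ for every $\mathbf{x}\in\mathfrak{G}$ (for $\tilde\Phi$: for every $\mathbf{x}\in G^{\mathbb{Z}}$). For a topological Markov chain $\mathfrak{K}\subseteq K^{\mathbb{Z}}$ over a finite alphabet $K$, $(\mathfrak{K},\Phi_{\mathfrak{K}})$ is an affine cellular automaton if its local rule is $(a,b)\mapsto\eta(a)+\rho(b)+c$, where $+$ is an Abelian group operation on $K$, $\eta,\rho$ are commuting automorphisms of $(K,+)$, and $c\in K$. For a topological Markov chain $\mathfrak{B}\subseteq B^{\mathbb{Z}}$ over a finite alphabet $B$, $(\mathfrak{B},\mathbf{g}_{\mathfrak{B}})$ is a translation if $\mathbf{g}_{\mathfrak{B}}=\mathbf{s}\circ\sigma$, where $\mathbf{s}:B^{\mathbb{Z}}\to B^{\mathbb{Z}}$ is the $1$-block code whose local rule is a permutation $s:B\to B$. *)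

(* Defs.v *)
From mathcomp Require Import all_boot all_order all_algebra.
From mathcomp Require Import all_classical topology.

Set Implicit Arguments.
Unset Strict Implicit.
Unset Printing Implicit Defensive.

Import GRing.Theory.
Local Open Scope ring_scope.
Local Open Scope classical_set_scope.

(* Points are plain functions int -> A; the product of discrete topologies is
   attached through the (convertible) library aliases. *)
Definition full_shift (A : choiceType) : topologicalType :=
  {ptws int -> discrete_topology A}.

Section ShiftSpaces.
Variable A : choiceType.
Implicit Types (X : set (full_shift A)) (w : seq A).

Definition shift (x : full_shift A) : full_shift A := fun i => x (i + 1).

Definition subshift X : Prop := closed X /\ shift @` X = X.

Definition allowed X w : Prop :=
  exists2 x, X x &
    exists i : int, mkseq (fun j : nat => x (i + j%:Z)) (size w) = w.

(* Quantifying over both u and v makes the implication an equivalence: the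
   followers of an allowed word ending in a depend on a only. *)
Definition topological_markov_chain X : Prop :=
  subshift X /\
  forall (u v : seq A) (a b : A),
    allowed X (rcons u a) -> allowed X (rcons v a) ->
    allowed X (rcons (rcons u a) b) -> allowed X (rcons (rcons v a) b).

Definition uses_all_letters X : Prop :=
  forall a : A, exists2 x, X x & exists i, x i = a.

Definition ca (phi : A -> A -> A) (x : full_shift A) : full_shift A :=
  fun i => phi (x i) (x (i + 1)).

Definition cellular_automaton X (phi : A -> A -> A) : Prop :=
  set_fun X X (ca phi).

Definition structurally_compatible X (phi : A -> A -> A) : Prop :=
  cellular_automaton X phi /\
  forall x y : full_shift A, X x -> X y ->
    X ((fun i => phi (x i) (y i)) : full_shift A).

Definition right_permutative (phi : A -> A -> A) : Prop :=
  forall w : A, bijective (phi w).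

Definition N_scaling (N : nat) X (phi : A -> A -> A) : Prop :=
  forall x, X x -> iter N (ca phi) x 0 = phi (x 0) (x N%:Z).

End ShiftSpaces.

Definition block_code (A C : choiceType) (theta : A -> C)
  (x : full_shift A) : full_shift C := fun i => theta (x i).

Definition homeomorphism_between (S T : topologicalType)
    (X : set S) (Y : set T) (f : S -> T) : Prop :=
  [/\ set_fun X Y f, {within X, continuous f} &
   exists g : T -> S,
     [/\ set_fun Y X g, {within Y, continuous g},
         {in X, cancel f g} & {in Y, cancel g f}]].

Definition conjugate_through_1_block (A C : choiceType)
    (X : set (full_shift A)) (F : full_shift A -> full_shift A)
    (Y : set (full_shift C)) (H : full_shift C -> full_shift C) : Prop :=
  exists theta : A -> C,
    homeomorphism_between X Y (block_code theta) /\
    forall x, X x -> block_code theta (F x) = H (block_code theta x).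

(* The product of two shift spaces is a shift space over the product alphabet;
   (K * B)^Z stands for K^Z * B^Z. *)
Definition prod_shift (K B : choiceType)
    (X : set (full_shift K)) (Y : set (full_shift B)) :
    set (full_shift (K * B)%type) :=
  [set z | X (block_code fst z) /\ Y (block_code snd z)].

Definition prod_map (K B : choiceType)
    (F : full_shift K -> full_shift K) (H : full_shift B -> full_shift B)
    (z : full_shift (K * B)%type) : full_shift (K * B)%type :=
  fun i => (F (block_code fst z) i, H (block_code snd z) i).

Definition affine_ca (K : finZmodType) (X : set (full_shift K))
    (psi : K -> K -> K) : Prop :=
  cellular_automaton X psi /\
  exists (eta rho : {additive K -> K}) (c : K),
    [/\ bijective eta, bijective rho, eta \o rho =1 rho \o eta &
        forall a b, psi a b = eta a + rho b + c].

Definition translation_map (B : choiceType) (s : B -> B) :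
    full_shift B -> full_shift B := block_code s \o @shift B.

Definition translation (B : finType) (X : set (full_shift B)) (s : B -> B) :
    Prop :=
  bijective s /\ set_fun X X (translation_map s).

(* Main.v *)
Require Import Defs.
From HB Require Import structures.
From mathcomp Require Import all_boot all_order all_algebra all_fingroup.
From mathcomp Require Import all_solvable.
From mathcomp Require Import all_classical topology.
From mathcomp Require Import zify.

Set Implicit Arguments.
Unset Strict Implicit.
Unset Printing Implicit Defensive.

Import Order.TTheory GRing.Theory Num.Theory.
Import FiniteModule.
Local Open Scope ring_scope.

(** The theorem splits into a statement on the binary operation [phi] and a
    statement on the chain [X].

    Write [L_a] for the left translation [b |-> phi a b], a permutation of [G].
    Scaling on the full shift has two algebraic consequences. The automaton
    commutes with its [N]-th power, whose local rule reads only the coordinates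
    0 and [N]; comparing the two compositions gives the medial law
    [phi (phi a b) (phi c d) = phi (phi a c) (phi b d)] ([scaling_medial]).
    Moreover, if two letters cannot be told apart after two steps, they cannot be
    told apart after [N] steps, so that [L_(phi a b) = L_(phi a' b)] for all [b]
    forces [L_a = L_a'] ([scaling_reduced]).

    From these two facts the quotients [L_b^-1 L_a] form an abelian group [D] of
    permutations of [G] ([displ_group_set], [displ_abelian]). Fix a letter [o] and
    put [t_a = L_a L_o^-1], an element of [D]; then
    [phi a b = t_a (L_o b)]. The map [t] is equivariant along an automorphism
    [eta] of [D], [t_(d y) = eta d * t_y] ([displacement_act]), and conjugation by
    [L_o] is another automorphism [rho] of [D] ([displ_conj]). Hence every [D]-orbit
    contains exactly one point with [t = 1], and each letter is uniquely
    [g = kappa(g) . beta(g)] with [kappa(g)] in [D] and [beta(g)] in the class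
    [t = 1]. In these coordinates [phi] is the product of
    [eta k + rho l + c] and of a permutation of the second coordinate
    ([medial_decomposition]).

    A topological Markov chain is the set of bi-infinite paths of its relation
    [E] of allowed pairs ([tmc_vertex_shift]), and structural compatibility says
    that [E] is closed under [phi] applied componentwise. Since [phi] acts
    on the [K]-coordinate injectively in each argument and on the [B]-coordinate
    through its right argument only, counting shows that such an [E] is the
    product of its projections ([closed_subset_product]). Therefore [X] is the
    product of the chains of bi-infinite paths of these projections, and the
    letter map [g |-> (kappa g, beta g)] is the conjugacy. *)

(** * Algebraic consequences of scaling *)

Section NScaling.
Variables (G : finType) (phi : G -> G -> G) (N : nat).
Hypothesis N_gt1 : (2 <= N)%N.
Hypothesis scaling : N_scaling N (@classical_sets.setT (full_shift G)) phi.
Local Notation "a • b" := (phi a b) (at level 40, left associativity).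

Lemma iter_ca_translate n (x : full_shift G) (c : int) :
  iter n (ca phi) (fun i => x (i + c)) = (fun i => iter n (ca phi) x (i + c)).
Proof.
elim: n => [|n IHn] //=; rewrite IHn; apply/funext => i.
by rewrite /ca addrAC.
Qed.

(** Compare [ca phi \o (ca phi)^N] and [(ca phi)^N \o ca phi] at coordinate 0. The
    four coordinates 0, 1, [N], [N + 1] involved are distinct because [2 <= N],
    hence carry arbitrary letters. *)
Lemma scaling_medial a b c d : (a • b) • (c • d) = (a • c) • (b • d).
Proof.
pose x : full_shift G := fun i : int =>
  if i == 0 then a else if i == 1 then c else if i == N%:Z then b else d.
have x0 : x 0 = a by [].
have x1 : x 1 = c by [].
have xN : x N%:Z = b.
  by rewrite /x ifF; [rewrite ifF; [rewrite eqxx|lia]|lia].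
have xN1 : x (N%:Z + 1) = d by rewrite /x !ifF //; lia.
have Nx (y : full_shift G) (i : int) :
    iter N (ca phi) y i = y i • y (i + N%:Z).
  have := @scaling (fun j => y (j + i)) I.
  by rewrite iter_ca_translate !add0r addrC.
have : iter N (ca phi) (ca phi x) 0 = ca phi (iter N (ca phi) x) 0.
  by rewrite -iterSr.
rewrite Nx /ca !Nx !add0r ?x0 ?x1 [1 + _]addrC ?xN ?xN1.
by move=> ->.
Qed.

(** Two configurations that differ only at 0, by [a] and [a'], agree on the
    nonnegative coordinates after two steps, hence after [N] steps, where scaling
    reads off [a • c] and [a' • c]. *)
Lemma scaling_reduced a a' : (forall b c, (a • b) • c = (a' • b) • c) ->
  forall c, a • c = a' • c.
Proof.
move=> aa c.
pose x e : full_shift G := fun i => if i == 0 then e else c.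
have eq_right n (y z : full_shift G) : (forall i, 0 <= i -> y i = z i) ->
    forall i, 0 <= i -> iter n (ca phi) y i = iter n (ca phi) z i.
  by move=> yz; elim: n => [|n IHn] //= i i0; rewrite /ca !IHn //; lia.
have E : forall i, 0 <= i -> iter 2 (ca phi) (x a) i = iter 2 (ca phi) (x a') i.
  move=> i i0; rewrite /= /ca /x; case: (eqVneq i 0) => [->|inz] //=.
  by rewrite !ifF //; lia.
have := eq_right (N - 2)%N _ _ E 0 (lexx _).
have xN e : x e N%:Z = c by rewrite /x ifF //; lia.
by rewrite -!iterD subnK // !(scaling I) !xN.
Qed.

End NScaling.

(** * Medial left quasigroups *)

(** The operation is, up to a bijection of its carrier, the product of an affine
    operation on [K] and of the operation [(x, y) |-> s y] on [B]. *)
Definition affine_permutation_product (G : finType) (phi : G -> G -> G) : Prop :=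
  exists (K : finZmodType) (B : finType) (kappa : G -> K) (beta : G -> B)
         (eta rho : {additive K -> K}) (c : K) (s : B -> B),
    [/\ bijective (fun g => (kappa g, beta g)), [/\ bijective eta,
        bijective rho & eta \o rho =1 rho \o eta], bijective s,
        forall a b, kappa (phi a b) = eta (kappa a) + rho (kappa b) + c &
        forall a b, beta (phi a b) = s (beta b)].

Section MedialLeftQuasigroup.
Variables (G : finType) (phi : G -> G -> G).
Local Notation "a • b" := (phi a b) (at level 40, left associativity).
Hypothesis phi_inj : forall a, injective (phi a).
Hypothesis medial : forall a b c d, (a • b) • (c • d) = (a • c) • (b • d).
Hypothesis reduced : forall a a',
  (forall b c, (a • b) • c = (a' • b) • c) -> forall c, a • c = a' • c.

Local Open Scope group_scope.

Definition ltrans a : {perm G} := perm (@phi_inj a).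
Local Notation L := ltrans.

Lemma ltransE a b : L a b = a • b.
Proof. by rewrite permE. Qed.

Lemma ltrans_eqP a a' : L a = L a' <-> forall c, a • c = a' • c.
Proof.
split=> [LL c|aa]; first by rewrite -!ltransE LL.
by apply/permP => c; rewrite !ltransE.
Qed.

(** The medial law in terms of left translations. Products of permutations are
    read from left to right: [L c * L (a • b)] applies [L c] first. *)
Lemma ltrans_medial a b c : L c * L (a • b) = L b * L (a • c).
Proof. by apply/permP => d; rewrite !permM !ltransE medial. Qed.

(** As [(a • c) • (b • d) = L (a • b) (c • d)], the permutation [L (a • b)]
    determines the two-step products [(a • c) • d'], to which [reduced] applies. *)
Lemma ltrans_cancel_factor a a' b : L (a • b) = L (a' • b) -> L a = L a'.
Proof.
move=> Lab; apply/ltrans_eqP/reduced => c d.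
have [b' <-] : exists b', b • b' = d.
  by exists ((L b)^-1 d); rewrite -ltransE permKV.
by rewrite medial [RHS]medial; move/ltrans_eqP: Lab.
Qed.

Definition left_translations : {set {perm G}} := [set L a | a in G].

(** Right multiplication by [b] acts on left translations, as
    [L x |-> L (x • b)] is the map [p |-> L (p b)]. It is injective by
    [ltrans_cancel_factor], hence onto by finiteness. *)
Lemma ltrans_mulr_onto b e : exists x, L (x • b) = L e.
Proof.
pose h (p : {perm G}) := L (p b).
have hE x : h (L x) = L (x • b) by rewrite /h ltransE.
have hT : h @: left_translations = left_translations.
  apply/eqP; rewrite eqEcard (@card_in_imset _ _ h).
    rewrite leqnn andbT; apply/fintype.subsetP => _ /imsetP[_ /imsetP[x _ ->] ->].
    by rewrite hE; apply: imset_f.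
  move=> _ _ /imsetP[x _ ->] /imsetP[y _ ->]; rewrite !hE.
  exact: ltrans_cancel_factor.
have : L e \in h @: left_translations by rewrite hT; apply: imset_f.
by case/imsetP => _ /imsetP[x _ ->] ->; exists x.
Qed.

(** The key to the group structure: by the medial law
    [L a * L (x • b) = L b * L (x • a)], where [L (x • b)] can be made equal to any
    given [L g]. *)
Lemma left_translations_rcoset g b : left_translations :* L g = L b *: left_translations.
Proof.
apply/eqP; rewrite eqEcard card_rcoset card_lcoset leqnn andbT.
apply/fintype.subsetP => _ /rcosetP[_ /imsetP[a _ ->] ->].
have [x Lx] := ltrans_mulr_onto b g.
apply/lcosetP; exists (L (x • a)); first exact: imset_f.
by rewrite -Lx ltrans_medial.
Qed.

Variable o : G.

(** The displacement group; by the next two lemmas it depends neither on the base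
    point nor on the side on which the translation is cancelled. *)
Definition displ : {set {perm G}} := (L o)^-1 *: left_translations.

Lemma displ_rcoset b : displ = left_translations :* (L b)^-1.
Proof.
apply: (canRL (rcosetK _)).
by rewrite /displ -mulgA (left_translations_rcoset b o) lcosetK.
Qed.

Lemma displ_lcoset b : displ = (L b)^-1 *: left_translations.
Proof.
by apply: (canRL (lcosetK _)); rewrite (displ_rcoset o) mulgA -(left_translations_rcoset o) rcosetK.
Qed.

Lemma mem_displ a b : (L b)^-1 * L a \in displ.
Proof.
by rewrite (displ_lcoset b); apply/lcosetP; exists (L a) => //; apply: imset_f.
Qed.

Lemma displP d b : d \in displ -> exists a, d = (L b)^-1 * L a.
Proof.
by rewrite (displ_lcoset b) => /lcosetP[_ /imsetP[a _ ->] ->]; exists a.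
Qed.

Lemma displPr d b : d \in displ -> exists a, d = L a * (L b)^-1.
Proof.
by rewrite (displ_rcoset b) => /rcosetP[_ /imsetP[a _ ->] ->]; exists a.
Qed.

Lemma displ_group_set : group_set displ.
Proof.
apply/group_setP; split=> [|d e dD eD]; first by rewrite -(mulVg (L o)) mem_displ.
have [a ->] := displP o dD; have [b ->] := displP a eD.
by rewrite mulgA mulgK mem_displ.
Qed.

Canonical displ_group : {group {perm G}} := group displ_group_set.

Lemma displ_abelian : abelian displ_group.
Proof.
apply/centsP => d dD e eD.
have [a ->] := displP o dD; have [b ->] := displP o eD.
have heap : L b * (L o)^-1 * L a = L a * (L o)^-1 * L b.
  (* A quotient on the left becomes a quotient on the right with a fixed
     denominator, after which the medial law swaps a and b. *)
  have E c : (L o)^-1 * L c = L (o • c) * (L (o • o))^-1.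
    by apply: (canLR (mulKg _)); rewrite mulgA -ltrans_medial mulgK.
  by rewrite -!mulgA !E !mulgA ltrans_medial.
by rewrite /commute -!mulgA; congr (_ * _); rewrite !mulgA heap.
Qed.

(** As a function this is [L_a] after the inverse of [L_o]: it turns the
    operation [a • b] into the action of an element of [displ] on [L o b]. *)
Definition displacement a := (L o)^-1 * L a.

Lemma displacement_mem a : displacement a \in displ.
Proof. exact: mem_displ. Qed.

Lemma displacementP d : d \in displ -> exists a, d = displacement a.
Proof. exact: displP. Qed.

Lemma displacement_base : displacement o = 1.
Proof. exact: mulVg. Qed.

Lemma displacement_eq a a' : displacement a = displacement a' <-> L a = L a'.
Proof. by rewrite /displacement; split=> [/mulgI|->]. Qed.

Lemma ltrans_displacement a b : a • b = displacement a (L o b).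
Proof. by rewrite permM permK ltransE. Qed.

(** With [y = o • b] and [d = displacement a], the point [d y] is [a • b]; the
    medial law makes [L (o • b)^-1 * L (a • b)] independent of [b], so it can be
    computed for the [c] with [o • c = o]. *)
Lemma displacement_act d y : d \in displ -> displacement (d y) = displacement y * displacement (d o).
Proof.
case/displacementP => a ->.
have [b <-] : exists b, o • b = y.
  by exists ((L o)^-1 y); rewrite -ltransE permKV.
have [c oc] : exists c, o • c = o.
  by exists ((L o)^-1 o); rewrite -ltransE permKV.
have ab z : a • z = displacement a (o • z) by rewrite ltrans_displacement ltransE.
have -> : displacement a o = a • c by rewrite ab oc.
rewrite -ab /displacement -mulgA; congr (_ * _).
have E z : L (z • b) = (L c)^-1 * L b * L (z • c).
  by rewrite -mulgA -ltrans_medial mulKg.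
by rewrite !E oc !mulgA mulgK.
Qed.

Lemma displacement_act_inj d d' : d \in displ -> d' \in displ ->
  displacement (d o) = displacement (d' o) -> d = d'.
Proof.
case/displacementP => a -> /displacementP[a' ->] /displacement_eq.
by rewrite !permM !ltransE => /ltrans_cancel_factor/displacement_eq.
Qed.

Lemma displ_conj d : d \in displ -> d ^ L o \in displ.
Proof. by case/(displPr o) => a ->; rewrite conjgE mulgVK mem_displ. Qed.

(** The abelian group [displ], written additively. *)
Local Notation K := (fmod_of displ_abelian).
Local Open Scope ring_scope.

Definition eta_fun (k : K) : K := fmod displ_abelian (displacement (fmval k o)).
Definition rho_fun (k : K) : K := fmod displ_abelian (fmval k ^ L o)%g.

(** [fmvalA] phrased with [fmval] instead of [val], for rewriting. *)
Lemma fmvalD (k l : K) : fmval (k + l) = (fmval k * fmval l)%g.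
Proof. exact: fmvalA. Qed.

Lemma fmval_displacement a : fmval (fmod displ_abelian (displacement a)) = displacement a.
Proof. exact: (fmodK _ (displacement_mem a)). Qed.

Lemma fmval_eta k : fmval (eta_fun k) = displacement (fmval k o).
Proof. exact: fmval_displacement. Qed.

Lemma fmval_rho k : fmval (rho_fun k) = (fmval k ^ L o)%g.
Proof. exact: (fmodK _ (displ_conj (fmodP k))). Qed.

Lemma eta_is_nmod_morphism : nmod_morphism eta_fun.
Proof.
have etaD : {morph eta_fun : k l / k + l}.
  move=> k l; apply: fmod_inj; rewrite fmvalD !fmval_eta fmvalD permM.
  by rewrite (displacement_act _ (fmodP l)).
by split=> //; apply: (@addrI _ (eta_fun 0)); rewrite -etaD !addr0.
Qed.
HB.instance Definition _ :=
  GRing.isNmodMorphism.Build K K eta_fun eta_is_nmod_morphism.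

Lemma rho_is_nmod_morphism : nmod_morphism rho_fun.
Proof.
have rhoD : {morph rho_fun : k l / k + l}.
  by move=> k l; apply: fmod_inj; rewrite fmvalD !fmval_rho fmvalD conjMg.
by split=> //; apply: (@addrI _ (rho_fun 0)); rewrite -rhoD !addr0.
Qed.
HB.instance Definition _ :=
  GRing.isNmodMorphism.Build K K rho_fun rho_is_nmod_morphism.

Lemma eta_inj : injective eta_fun.
Proof.
move=> k l /(congr1 (@fmval _ _ _)); rewrite !fmval_eta.
by move=> /(displacement_act_inj (fmodP k) (fmodP l))/fmod_inj.
Qed.

Lemma rho_inj : injective rho_fun.
Proof.
move=> k l /(congr1 (@fmval _ _ _)); rewrite !fmval_rho.
by move=> /conjg_inj/fmod_inj.
Qed.

(** A transversal of the orbits of [displ]: as [eta_fun] is bijective, for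
    each [g] exactly one [d] in [displ] makes the displacement of [d g] trivial. *)
Definition base_class := {g : G | displacement g == 1%g}.

(** Chosen so that [(kappa g)^-1] moves [g] into [base_class]: the displacement
    of [g] gets multiplied by [eta_fun (- kappa g)]. *)
Definition kappa g : K := invF eta_inj (fmod displ_abelian (displacement g)).

Lemma eta_kappa g : displacement (fmval (kappa g) o) = displacement g.
Proof. by rewrite -fmval_eta f_invF fmval_displacement. Qed.

Lemma beta_subproof g : displacement ((fmval (kappa g))^-1%g g) == 1%g.
Proof.
have kD : fmval (kappa g) \in displ by exact: fmodP.
have kVD : (fmval (kappa g))^-1%g \in displ by rewrite groupV.
by rewrite displacement_act // -eta_kappa -displacement_act // permK displacement_base.
Qed.

Definition beta g : base_class :=
  exist (fun g => displacement g == 1%g) _ (beta_subproof g).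

Lemma kappa_beta g : fmval (kappa g) (val (beta g)) = g.
Proof. exact: permKV. Qed.

Lemma kappa_beta_unique (k : K) (x : base_class) :
  kappa (fmval k (val x)) = k /\ beta (fmval k (val x)) = x.
Proof.
have kk : kappa (fmval k (val x)) = k.
  by apply: eta_inj; rewrite f_invF displacement_act ?fmodP // (eqP (valP x)) mul1g.
by split=> //; apply: val_inj; rewrite /= kk permK.
Qed.

Definition shift_const : K := kappa (o • o).
Definition base_map (x : base_class) : base_class := beta (o • val x).

(** Left translations by elements of [base_class] equal [L o], and by the medial
    law the class of [o • x] depends only on [L x]. *)
Lemma kappa_base (x : base_class) : kappa (o • val x) = shift_const.
Proof.
congr (invF _ (fmod _ _)); rewrite /displacement; congr (_ * _)%g.
have /displacement_eq Lx : displacement (val x) = displacement o.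
  by rewrite displacement_base; exact: eqP (valP x).
by apply: (@mulgI _ (L o)); rewrite ltrans_medial Lx.
Qed.

(** [a • b] is obtained from [o • beta b] by the action of [rho_fun (kappa b)],
    because [L o] conjugates [kappa b] into it, and then of the displacement of
    [a], which is [eta_fun (kappa a)]; uniqueness of coordinates concludes. *)
Lemma kappa_beta_op a b :
  kappa (a • b) = eta_fun (kappa a) + rho_fun (kappa b) + shift_const /\
  beta (a • b) = base_map (beta b).
Proof.
rewrite -(kappa_base (beta b)) /base_map.
set x := val (beta b); set k := kappa (o • x).
suff -> : a • b =
  fmval (eta_fun (kappa a) + rho_fun (kappa b) + k) (val (beta (o • x))).
  exact: kappa_beta_unique.
rewrite addrC [_ + rho_fun _]addrC !fmvalD !permM kappa_beta fmval_eta eta_kappa.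
by rewrite fmval_rho -(ltransE o x) permJ kappa_beta -ltrans_displacement.
Qed.

Lemma base_map_inj : injective base_map.
Proof.
move=> x y xy; apply/val_inj/(@phi_inj o).
rewrite -[LHS]kappa_beta -[RHS]kappa_beta !kappa_base.
by rewrite -[beta (o • val x)]/(base_map x) xy.
Qed.

Lemma kappa_beta_bij : bijective (fun g => (kappa g, beta g)).
Proof.
exists (fun p : K * base_class => fmval p.1 (val p.2)) => [g|[k x]] /=.
  exact: kappa_beta.
by have [-> ->] := kappa_beta_unique k x.
Qed.

(** The medial law read in the [K]-coordinate, with only the second factor
    nonzero. *)
Lemma eta_rho_comm : eta_fun \o rho_fun =1 rho_fun \o eta_fun.
Proof.
move=> k /=; have [g _ gK] := kappa_beta_bij.
have kg l x : kappa (g (l, x)) = l by have [] := gK (l, x).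
have b0 := beta o.
have := congr1 kappa (medial (g (0, b0)) (g (k, b0)) (g (0, b0)) (g (0, b0))).
rewrite !(fun a b => (kappa_beta_op a b).1) !kg !raddf0.
rewrite !add0r !addr0 !raddfD addrA => /addIr/addIr.
by rewrite [RHS]addrC => /addIr.
Qed.

Lemma pointed_medial_decomposition : affine_permutation_product phi.
Proof.
exists K, base_class, kappa, beta, eta_fun, rho_fun, shift_const, base_map.
split.
- exact: kappa_beta_bij.
- by split; [exact/injF_bij/eta_inj|exact/injF_bij/rho_inj|exact: eta_rho_comm].
- exact/injF_bij/base_map_inj.
- by move=> a b; have [] := kappa_beta_op a b.
- by move=> a b; have [] := kappa_beta_op a b.
Qed.
End MedialLeftQuasigroup.

Theorem medial_decomposition (G : finType) (phi : G -> G -> G) :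
  (forall a, injective (phi a)) ->
  (forall a b c d, phi (phi a b) (phi c d) = phi (phi a c) (phi b d)) ->
  (forall a a', (forall b c, phi (phi a b) c = phi (phi a' b) c) ->
     forall c, phi a c = phi a' c) ->
  affine_permutation_product phi.
Proof.
move=> phi_inj medial reduced.
have [o _|G0] := pickP (fun _ : G => true).
  exact: pointed_medial_decomposition o.
have noG (P : Type) : G -> P by move=> g; have := G0 g.
(* Over the empty alphabet, K is the trivial group and B is empty. *)
exists 'I_1, G, (noG _), id, idfun, idfun, 0, id; split.
- by exists snd => [g|[k g]]; apply: noG.
- by split=> //; exists idfun.
- by exists idfun.
- by move=> a; apply: noG.
- by move=> a; apply: noG.
Qed.

(** * Subsets closed under a product operation *)

(** Left translations by elements of [E] permute [E], so [y = op x y'] with [y']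
    in [E]. The elements [op u y'], for [u] in [E], all have the same [beta] as
    [y], while their [kappa] takes as many values as [kappa] does on [E], hence
    all of them. *)
Lemma closed_subset_product (M : finType) (K B : finType) (op : M -> M -> M)
    (kappa : M -> K) (beta : M -> B) (f : M -> K -> K) (s : B -> B)
    (E : {set M}) :
  (forall u, injective (op u)) -> (forall y, injective (f y)) ->
  (forall u y, kappa (op u y) = f y (kappa u)) ->
  (forall u y, beta (op u y) = s (beta y)) ->
  {in E &, forall u y, op u y \in E} ->
  {in E &, forall x y, exists2 z, z \in E & kappa z = kappa x /\ beta z = beta y}.
Proof.
move=> op_inj f_inj kop bop Eop x y xE yE.
have opE u : u \in E -> op u @: E = E.
  move=> uE; apply/eqP; rewrite eqEcard (card_imset _ (op_inj u)) leqnn andbT.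
  by apply/fintype.subsetP => _ /imsetP[v vE ->]; exact: Eop.
have /imsetP[y' y'E yy'] : y \in op x @: E by rewrite opE.
have fE : f y' @: (kappa @: E) = kappa @: E.
  apply/eqP; rewrite eqEcard (card_imset _ (f_inj y')) leqnn andbT.
  apply/fintype.subsetP => _ /imsetP[_ /imsetP[u uE ->] ->].
  by rewrite -kop; apply/imset_f/Eop.
have /imsetP[_ /imsetP[u uE ->] xu] : kappa x \in f y' @: (kappa @: E).
  by rewrite fE imset_f.
by exists (op u y'); [exact: Eop|rewrite kop xu yy' !bop].
Qed.

(** * Topological Markov chains as vertex shifts *)

Local Open Scope classical_set_scope.

Section FullShift.
Variable A : choiceType.
Implicit Types (X : set (full_shift A)) (E : A -> A -> Prop) (x y : full_shift A).

Lemma coordinate_continuous (i : int) :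
  continuous (fun x : full_shift A => x i : discrete_topology A).
Proof. exact: (@proj_continuous int (fun=> discrete_topology A) i). Qed.

Lemma cvg_full_shift (F : set_system (full_shift A)) (FF : Filter F) x :
  (forall i, F [set y | y i = x i]) -> F --> x.
Proof.
move=> Fx; apply/cvg_sup => i U [V [[W _ <-] Wx] VU].
by apply: filterS (Fx i) => y /= yx; apply: VU; rewrite /= /proj yx.
Qed.

Lemma subshift_translate X (c : int) x :
  subshift X -> X x -> X (fun i => x (i + c)).
Proof.
move=> [_ XS].
have Xr y : X y -> X (fun i => y (i + 1)).
  by move=> Xy; rewrite -XS; exists y.
have Xl y : X y -> X (fun i => y (i - 1)).
  rewrite -{1}XS => -[z Xz <-]; rewrite (_ : (fun _ => _) = z) //.
  by apply/funext => i; rewrite /shift subrK.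
move=> Xx; elim/int_rec: c => [|n Xn|n Xn].
- by rewrite (_ : (fun _ => _) = x) //; apply/funext => i; rewrite addr0.
- rewrite (_ : (fun _ => _) = (fun i => x (i + 1 + n%:Z))); first exact: Xr Xn.
  by apply/funext => i; congr x; lia.
rewrite (_ : (fun _ => _) = (fun i => x (i - 1 + - n%:Z))); first exact: Xl Xn.
by apply/funext => i; congr x; lia.
Qed.

Definition vertex_shift E : set (full_shift A) :=
  [set x | forall i, E (x i) (x (i + 1))].

Lemma closed_vertex_shift E : closed (vertex_shift E).
Proof.
rewrite (_ : vertex_shift E =
  \bigcap_(i in setT) [set x | E (x i) (x (i + 1))]); last first.
  by apply/seteqP; split => [x Ex i _|x Ex i]; [exact: Ex|exact: (Ex i)].
apply: closed_bigI => i _ x /(_ [set y | y i = x i /\ y (i + 1) = x (i + 1)]).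
case; last by move=> y /= [+ [yi yi1]]; rewrite yi yi1.
apply: (@filterI _ (nbhs x)).
  exact: (coordinate_continuous (discrete_set1 (x i : discrete_topology A))).
exact: (coordinate_continuous
  (discrete_set1 (x (i + 1) : discrete_topology A))).
Qed.

Lemma allowed_pairP X (a b : A) : subshift X ->
  allowed X [:: a; b] <-> exists2 x, X x & x 0 = a /\ x 1 = b.
Proof.
move=> sX; split=> [[x Xx [i [xa xb]]]|[x Xx [<- <-]]].
  exists (fun j => x (j + i)); first exact: (@subshift_translate X i x).
  by rewrite -xa -xb; split; congr x; lia.
by exists x => //; exists 0; rewrite /mkseq /= !add0r.
Qed.

(** Two paths through the same vertex [a] can be spliced there: follow the one
    carrying [rcons v a] up to [a], then the one carrying [rcons u a] and [b]. *)
Lemma vertex_shift_tmc E : topological_markov_chain (vertex_shift E).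
Proof.
have inv x c : vertex_shift E x -> vertex_shift E (fun i => x (i + c)).
  by move=> Ex i; rewrite (_ : i + 1 + c = i + c + 1) //; lia.
split; first split; first exact: closed_vertex_shift.
  apply/seteqP; split=> [_ [x Ex <-]|x Ex]; first exact: (inv x 1).
  exists (fun i => x (i - 1)); first exact: inv.
  by apply/funext => i; rewrite /shift addrK.
move=> u v a b _ [y Ey [j yj]] [x Ex [i xi]].
have ya : y (j + (size v)%:Z) = a.
  move: yj => /(congr1 (fun w => nth a w (size v))).
  by rewrite nth_mkseq ?size_rcons // nth_rcons ltnn eqxx.
have yv k : (k < size v)%N -> y (j + k%:Z) = nth a v k.
  move: yj => /(congr1 (fun w => nth a w k)) + kv.
  by rewrite nth_mkseq ?size_rcons ?nth_rcons ?kv // leqW.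
have xa : x (i + (size u)%:Z) = a.
  move: xi => /(congr1 (fun w => nth a w (size u))).
  by rewrite nth_mkseq ?size_rcons // !nth_rcons size_rcons ltnS leqnn ltnn eqxx.
have xb : x (i + (size u).+1%:Z) = b.
  move: xi => /(congr1 (fun w => nth a w (size u).+1)).
  by rewrite nth_mkseq ?size_rcons // nth_rcons size_rcons ltnn eqxx.
pose z : full_shift A := fun k =>
  if k <= (size v)%:Z then y (j + k) else x (i + (size u)%:Z + (k - (size v)%:Z)).
exists z.
  move=> k; rewrite /z.
  case: (lerP k (size v)%:Z) => kv; case: (lerP (k + 1) (size v)%:Z) => kv1.
  - by rewrite addrA; exact: Ey.
  - have -> : k = (size v)%:Z by lia.
    rewrite ya -xa (_ : i + _ + _ = i + (size u)%:Z + 1); first exact: Ex.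
    by lia.
  - by lia.
  - by rewrite -(_ : i + (size u)%:Z + (k - (size v)%:Z) + 1 =
      i + (size u)%:Z + (k + 1 - (size v)%:Z)); [exact: Ex|lia].
exists 0; apply: (@eq_from_nth _ a); rewrite size_mkseq // => k kv.
rewrite nth_mkseq // add0r /z; move: kv; rewrite !size_rcons ltnS => kv.
rewrite !nth_rcons !size_rcons lez_nat.
have [kv'|kv'|->] := ltngtP k (size v).
- by rewrite ltnS (ltnW kv') yv.
- have -> : k = (size v).+1 by lia.
  rewrite ltnn eqxx -xb; congr x; lia.
- by rewrite ltnSn.
Qed.

(** The Markov property extends allowed pairs to allowed words of any length, so a
    path agrees with points of [X] on arbitrarily large windows, and [X] is
    closed. *)
Lemma tmc_vertex_shift X : topological_markov_chain X ->
  X = vertex_shift (fun a b => allowed X [:: a; b]).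
Proof.
move=> [sX mX]; apply/seteqP; split=> [x Xx i|x Ex].
  by exists x => //; exists i; rewrite /mkseq /= addr0.
have word i n : allowed X (mkseq (fun j => x (i + j%:Z)) n.+1).
  elim: n => [|n IHn].
    have [y Xy [k [yk _]]] := Ex i.
    by exists y => //; exists k; rewrite /mkseq /= yk addr0.
  move: IHn; rewrite (mkseqS _ n) => IHn.
  rewrite mkseqS mkseqS; apply: (mX [::]) IHn _ => /=.
    have [y Xy [k [yk _]]] := Ex (i + n%:Z).
    by exists y => //; exists k; rewrite /mkseq /= yk.
  by rewrite (_ : i + n.+1%:Z = i + n%:Z + 1); [exact: Ex|lia].
have /choice[y yP] : forall n : nat, exists y : full_shift A, X y /\
    forall i : int, `|i| <= n%:Z -> y i = x i.
  move=> n; have [y Xy [k yk]] := word (- n%:Z) (n.*2).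
  exists (fun i => y (i + (k + n%:Z))); split; first exact: (@subshift_translate X _ y).
  move=> i ilen; have [m im] : exists m : nat, i = - n%:Z + m%:Z.
    by exists (absz (i + n%:Z)); lia.
  move: yk => /(congr1 (fun w => nth (x 0) w m)).
  rewrite !nth_mkseq ?size_mkseq -?im; try lia.
  by move=> <-; congr y; lia.
have Cx : y @ \oo --> x.
  apply: cvg_full_shift => i; exists (absz i) => // n /= ni.
  by have [_ ->] := yP n; first by []; lia.
by apply: (closed_cvg X sX.1 _ x Cx); apply: nearW => n; have [] := yP n.
Qed.

End FullShift.

Lemma block_code_continuous (A C : choiceType) (theta : A -> C) :
  continuous (block_code theta).
Proof.
move=> x; apply: cvg_full_shift => [|i].
  exact: (@fmap_filter _ _ _ (nbhs x)).
have xi : nbhs x [set y : full_shift A | y i = x i].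
  exact: (coordinate_continuous (discrete_set1 (x i : discrete_topology A))).
by apply: (@filterS _ (nbhs x)) xi => y /= yx; rewrite /block_code yx.
Qed.

(** * The decomposition of the chain *)

Section Decomposition.
Variables (G : finType) (X : set (full_shift G)) (phi : G -> G -> G).
Hypothesis X_tmc : topological_markov_chain X.
Hypothesis X_compatible : structurally_compatible X phi.

Definition transition (a b : G) : Prop := allowed X [:: a; b].

Lemma transition_op a b c d : transition a b -> transition c d ->
  transition (phi a c) (phi b d).
Proof.
move=> /(allowed_pairP _ _ X_tmc.1)[x Xx [<- <-]].
move=> /(allowed_pairP _ _ X_tmc.1)[y Xy [<- <-]].
apply/(allowed_pairP _ _ X_tmc.1).
by exists (fun i => phi (x i) (y i)); [exact: X_compatible.2|].
Qed.

Definition image_transition (C : Type) (f : G -> C) (k l : C) : Prop :=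
  exists a b, [/\ transition a b, f a = k & f b = l].

(** [closed_subset_product] applied to the set of transitions inside [G * G] with
    the componentwise operation. *)
Lemma transition_product (K B : finType) (kappa : G -> K) (beta : G -> B)
    (psi : K -> K -> K) (s : B -> B) :
  (forall a, injective (phi a)) -> injective (fun g => (kappa g, beta g)) ->
  (forall l, injective (psi^~ l)) ->
  (forall a b, kappa (phi a b) = psi (kappa a) (kappa b)) ->
  (forall a b, beta (phi a b) = s (beta b)) ->
  forall a b, image_transition kappa (kappa a) (kappa b) ->
    image_transition beta (beta a) (beta b) -> transition a b.
Proof.
move=> phi_inj kb_inj psi_inj kop bop a b.
case=> [a1 [b1 [E1 ka kb]]] [a2 [b2 [E2 ba bb]]].
pose E := [set p : G * G | `[< transition p.1 p.2 >]]%SET.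
have EP p q : (p, q) \in E <-> transition p q by rewrite inE; split=> /asboolP.
have [] := @closed_subset_product _ _ _
  (fun u y : G * G => (phi u.1 y.1, phi u.2 y.2))
  (fun u => (kappa u.1, kappa u.2)) (fun u => (beta u.1, beta u.2))
  (fun y k => (psi k.1 (kappa y.1), psi k.2 (kappa y.2)))
  (fun y => (s y.1, s y.2)) E _ _ _ _ _ (a1, b1) (a2, b2).
- by move=> u [p q] [p' q'] [/phi_inj -> /phi_inj ->].
- by move=> y [p q] [p' q'] [/psi_inj -> /psi_inj ->].
- by move=> u y; rewrite !kop.
- by move=> u y; rewrite !bop.
- by move=> [u v] [y z] /EP uv /EP yz; apply/EP/transition_op.
- exact/EP.
- exact/EP.
move=> [a' b'] /EP E' [[ka' kb'] [ba' bb']].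
have -> : a = a' by apply: kb_inj; rewrite -ka -ba ka' ba'.
by have -> : b = b' by apply: kb_inj; rewrite -kb -bb kb' bb'.
Qed.

End Decomposition.

Theorem theorem4p3 (G : finType) (X : set (full_shift G)) (phi : G -> G -> G)
    (N : nat)
    (hX : topological_markov_chain X) (hG : uses_all_letters X)
    (hN : (2 <= N)%N)
    (hcomp : structurally_compatible X phi)
    (hperm : right_permutative phi)
    (hscal : N_scaling N X phi)
    (hext : N_scaling N (@setT (full_shift G)) phi) :
  exists (K : finZmodType) (B : finType)
         (XK : set (full_shift K)) (XB : set (full_shift B))
         (psi : K -> K -> K) (s : B -> B),
    [/\ topological_markov_chain XK,
        topological_markov_chain XB,
        affine_ca XK psi,
        translation XB s &
        conjugate_through_1_block X (ca phi)
          (prod_shift XK XB) (prod_map (ca psi) (translation_map s))].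
Proof.
have phi_inj a : injective (phi a) := bij_inj (hperm a).
have [K [B [kappa [beta [eta [rho [c [s]]]]]]]] :=
  medial_decomposition phi_inj (scaling_medial hN hext) (scaling_reduced hN hext).
case=> theta_bij [eta_bij rho_bij eta_rho] s_bij kop bop.
pose psi k l : K := eta k + rho l + c.
pose EK := image_transition X kappa; pose EB := image_transition X beta.
have prodE := transition_product hX hcomp phi_inj (bij_inj theta_bij)
  (psi := psi) (s := s).
have {}prodE a b : EK (kappa a) (kappa b) -> EB (beta a) (beta b) ->
    transition X a b.
  by apply: prodE => // l k k' /addIr/addIr/(bij_inj eta_bij).
exists K, B, (vertex_shift EK), (vertex_shift EB), psi, s; split.
- exact: vertex_shift_tmc.
- exact: vertex_shift_tmc.
- split; last by exists eta, rho, c; split.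
  move=> z Ez i; have [a [b [ab az bz]]] := Ez i.
  have [a' [b' [ab' az' bz']]] := Ez (i + 1).
  exists (phi a a'), (phi b b'); split; first exact: transition_op.
    by rewrite kop az az'.
  by rewrite kop bz bz'.
- split=> // z Ez i; have [a [b [ab az bz]]] := Ez (i + 1).
  exists (phi a a), (phi b b); split; first exact: transition_op.
    by rewrite bop az.
  by rewrite bop bz.
pose theta g := (kappa g, beta g).
have thetaX x : X x <-> prod_shift (vertex_shift EK) (vertex_shift EB)
    (block_code theta x).
  rewrite {1}(tmc_vertex_shift hX); split=> [Ex|[Kx Bx] i].
    by split=> i; exists (x i), (x (i + 1)); split=> //; exact: Ex.
  by apply: prodE; [exact: Kx|exact: Bx].
have [thetaV thetaK thetaVK] := theta_bij.
have codeVK (z : full_shift (K * B)%type) :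
    block_code theta (block_code thetaV z) = z.
  by apply/funext => i; exact: thetaVK.
exists theta; split; last first.
  by move=> x _; apply/funext => i; congr pair; [exact: kop|exact: bop].
split; first by move=> x /thetaX.
  by apply: continuous_subspaceT; exact: block_code_continuous.
exists (block_code thetaV); split.
- by move=> z Yz; apply/thetaX; rewrite codeVK.
- by apply: continuous_subspaceT; exact: block_code_continuous.
- by move=> x _; apply/funext => i; exact: thetaK.
- by move=> z _; exact: codeVK.
Qed.
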